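(* Let $F:B^{s_D}_{p_D}\to L_2$ be linear and continuous, where $s_D\in\mathbb{R}$, $p_D>1$. Let $B^{s_R}_{p_R}$ be a Besov space such that $B^{s_R}_{p_R}\subset B^{s_D}_{p_D}$ with continuous embedding, and let $u^\dagger$ be a minimum-$\|\cdot\|_{B^{s_R}_{p_R}}$-solution of $Fu=v$. For $\delta>0$ let $v^\delta\in L_2$ satisfy $\|v-v^\delta\|_{L_2}\le\delta$. Then, for each minimizer $u^{\alpha,\delta}$ of $$T_\alpha(u)=\|Fu-v^\delta\|_{L_2}^2+\alpha\|u\|_{B^{s_R}_{p_R}}^{p_R},\qquad u\in B^{s_D}_{p_D},$$ and the parameter rule $\alpha\asymp\delta$, one has $$\|u^{\alpha,\delta}-u^\dagger\|_{B^{s_R}_{p_R}}\to 0\quad\text{as }\delta\to0.$$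
   Context: All function spaces consist of functions or distributions on a fixed set $\Omega\subset\mathbb{R}^d$; $L_2=L_2(\Omega)$. $B^s_p:=B^s_{p,p}$ ($s\in\mathbb{R}$, $p>0$) denotes the Besov space with smoothness $s$ and both integrability indices equal to $p$. With a suitable wavelet basis $\{\psi_\lambda\}_{\lambda\in\Lambda}$ (with $|\lambda|$ the scale of the index $\lambda$), $B^s_p$ is equipped with the equivalent norm given by $$\|u\|_{B^s_p}^p=\sum_{\lambda\in\Lambda}2^{p(s+d(\frac12-\frac1p))|\lambda|}|u_\lambda|^p,\qquad u_\lambda=\langle u,\psi_\lambda\rangle .$$ For $u\in B^{s_D}_{p_D}\setminus B^{s_R}_{p_R}$ one sets $\|u\|_{B^{s_R}_{p_R}}=\infty$. The exact data are $v\in L_2$, and $v^\delta$ are noisy data with noise level $\delta$. A minimum-$\|\cdot\|_{B^{s_R}_{p_R}}$-solution of $Fu=v$ is an element $u^\dagger\in B^{s_R}_{p_R}$ with $Fu^\dagger=v$ whose $B^{s_R}_{p_R}$-norm is minimal among all solutions $u\in B^{s_D}_{p_D}$ of $Fu=v$. $A\asymp B$ means there are constants $c,C>0$ (here independent of $\delta$) with $cA\le B\le CA$.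
   Formalization: For p_R ≤ 1 the minimum-norm solution u† is additionally assumed to be the only one; without this the claim fails (e.g. p_R = 1, F depending on two same-scale coefficients only through u_1+u_2). For p_R > 1 nothing is added. *)

(* Defs.v *)
From HB Require Import structures.
From mathcomp Require Import all_boot all_order all_algebra.
From mathcomp Require Import finmap.
From mathcomp Require Import all_classical all_reals all_analysis.
From mathcomp Require Import summability.

Set Implicit Arguments.
Unset Strict Implicit.
Unset Printing Implicit Defensive.

Import Order.TTheory GRing.Theory Num.Theory.
Import numFieldNormedType.Exports.

Local Open Scope classical_set_scope.
Local Open Scope ring_scope.

(** * Lebesgue measure on R^d *)

Definition box (R : realType) (d : nat) (a b : 'rV[R]_d) : set 'rV[R]_d :=
  [set x | forall i, a ord0 i < x ord0 i <= b ord0 i].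

(* [+oo] on the sets that are not boxes, so that only coverings by boxes count
   in the outer measure below.  The case of [set0] only matters when [d = 0],
   where every box is the whole space. *)
Definition box_volume (R : realType) (d : nat) (A : set 'rV[R]_d) : \bar R :=
  if A == set0 then 0%E else
  ereal_inf [set (\prod_i Num.max (ab.2 ord0 i - ab.1 ord0 i) 0)%:E
            | ab in [set ab : 'rV[R]_d * 'rV[R]_d | A = box ab.1 ab.2]].

Lemma box_volume0 (R : realType) (d : nat) :
  box_volume (set0 : set 'rV[R]_d) = 0%E.
Proof. by rewrite /box_volume eqxx. Qed.

Lemma box_volume_ge0 (R : realType) (d : nat) (A : set 'rV[R]_d) :
  (0 <= box_volume A)%E.
Proof.
rewrite /box_volume; case: ifP => // _.
apply: le_ereal_inf_tmp => _ [ab _ <-]; rewrite lee_fin.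
by apply: prodr_ge0 => i _; rewrite le_max lexx orbT.
Qed.

Definition boxes (R : realType) (d : nat) : set (set 'rV[R]_d) :=
  [set A | exists ab : 'rV[R]_d * 'rV[R]_d, A = box ab.1 ab.2].

Definition lebesgue_outer_fun (R : realType) (d : nat) : set 'rV[R]_d -> \bar R :=
  @mu_ext _ (g_sigma_algebraType (@boxes R d)) R (@box_volume R d).

Definition lebesgue_outer (R : realType) (d : nat)
    : {outer_measure set 'rV[R]_d -> \bar R} :=
  HB.pack (@lebesgue_outer_fun R d) (isOuterMeasure.Build R 'rV[R]_d
    (@lebesgue_outer_fun R d)
    (@mu_ext0 _ (g_sigma_algebraType (@boxes R d)) R (@box_volume R d)
      (@box_volume0 R d) (@box_volume_ge0 R d))
    (@mu_ext_ge0 _ (g_sigma_algebraType (@boxes R d)) R (@box_volume R d)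
      (@box_volume_ge0 R d))
    (@le_mu_ext _ (g_sigma_algebraType (@boxes R d)) R (@box_volume R d))
    (@mu_ext_sigma_subadditive _ (g_sigma_algebraType (@boxes R d)) R
      (@box_volume R d) (@box_volume_ge0 R d))).

(* R^d with the sigma-algebra of its Lebesgue-measurable sets *)
Notation euclidean R d := (caratheodory_type (lebesgue_outer R d)).

Definition lebesgue (R : realType) (d : nat)
    : {measure set (euclidean R d) -> \bar R} :=
  [the {measure set (euclidean R d) -> \bar R} of
    (lebesgue_outer R d : set (euclidean R d) -> \bar R)].

Definition lebesgue_measurable (R : realType) (d : nat) (A : set 'rV[R]_d) :=
  measurable (A : set (euclidean R d)).

Definition lebesgue_on (R : realType) (d : nat) (Omega : set 'rV[R]_d)
    (mOmega : lebesgue_measurable Omega)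
    : {measure set (euclidean R d) -> \bar R} :=
  [the {measure set (euclidean R d) -> \bar R} of mrestr (lebesgue R d) mOmega].

(** * The space L_2(Omega) *)

(* Square integrable functions; the elements of L_2(Omega) are their classes
   modulo equality almost everywhere on Omega, see [L2_eq]. *)
Definition L2 (R : realType) (d : nat) (Omega : set 'rV[R]_d)
    (mOmega : lebesgue_measurable Omega) :=
  LfunType (lebesgue_on mOmega) (lee1n 2).

HB.instance Definition _ (R : realType) (d : nat) (Omega : set 'rV[R]_d)
    (mOmega : lebesgue_measurable Omega) := GRing.Lmodule.on (L2 mOmega).

Definition L2_norm (R : realType) (d : nat) (Omega : set 'rV[R]_d)
    (mOmega : lebesgue_measurable Omega) (f : L2 mOmega) : \bar R :=
  ('N[lebesgue_on mOmega]_2[EFin \o f])%E.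

Definition L2_dot (R : realType) (d : nat) (Omega : set 'rV[R]_d)
    (mOmega : lebesgue_measurable Omega) (f g : L2 mOmega) : R :=
  \int[lebesgue_on mOmega]_x (f x * g x).

Definition L2_eq (R : realType) (d : nat) (Omega : set 'rV[R]_d)
    (mOmega : lebesgue_measurable Omega) (f g : L2 mOmega) : Prop :=
  f = g %[ae lebesgue_on mOmega].

(** * Distributions on Omega *)

Definition iterated_partial (R : realType) (d : nat) (s : seq 'I_d)
    (f : 'rV[R]_d -> R) : 'rV[R]_d -> R :=
  foldr (fun i g => 'D_(delta_mx ord0 i) g) f s.

Definition support_of (R : realType) (d : nat) (f : 'rV[R]_d -> R)
    : set 'rV[R]_d :=
  closure [set x | f x != 0].

(* [f] is in C_c^oo(Omega): it is smooth since all its iterated partial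
   derivatives are everywhere (Frechet) differentiable. *)
Definition is_test_function (R : realType) (d : nat) (Omega : set 'rV[R]_d)
    (f : 'rV[R]_d -> R) : Prop :=
  [/\ forall (s : seq 'I_d) x, differentiable (iterated_partial s f) x,
      compact (support_of f) & support_of f `<=` Omega].

Definition test_function (R : realType) (d : nat) (Omega : set 'rV[R]_d) :=
  {f : 'rV[R]_d -> R | is_test_function Omega f}.

Definition is_distribution (R : realType) (d : nat) (Omega : set 'rV[R]_d)
    (u : test_function Omega -> R) : Prop :=
  (forall (a : R) (f g h : test_function Omega),
     (forall x, sval h x = a * sval f x + sval g x) ->
     u h = a * u f + u g) /\
  (forall K : set 'rV[R]_d, compact K -> K `<=` Omega ->
     exists (N : nat) (C : R), forall (f : test_function Omega) (M : R),
       support_of (sval f) `<=` K ->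
       (forall (s : seq 'I_d) x, (size s <= N)%N ->
          `|iterated_partial s (sval f) x| <= M) ->
       `|u f| <= C * M).

Definition regular_distribution (R : realType) (d : nat)
    (Omega : set 'rV[R]_d) (mOmega : lebesgue_measurable Omega)
    (f : L2 mOmega) : test_function Omega -> R :=
  fun phi => \int[lebesgue_on mOmega]_x (f x * sval phi x).

(** * Wavelet bases and Besov spaces *)

(* A wavelet basis (psi_lambda) of L_2(Omega) with its biorthogonal dual basis
   (equal to it when the basis is orthonormal).  [pairing u l] is
   <u, psi_l>; it is the inner product when [u] is square integrable, and for
   other distributions it is part of the data, since the wavelets need not be
   test functions.  Only its values on the Besov spaces below matter. *)
Record wavelet_basis (R : realType) (d : nat) (Omega : set 'rV[R]_d)
    (mOmega : lebesgue_measurable Omega) := WaveletBasis {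
  windex : countType;
  scale : windex -> nat;
  psi : windex -> L2 mOmega;
  dual_psi : windex -> L2 mOmega;
  pairing : (test_function Omega -> R) -> windex -> R;
  biorthogonal : forall l m, L2_dot (psi l) (dual_psi m) = (l == m)%:R;
  wavelet_expansion : forall f : L2 mOmega,
    (fun J => L2_norm
       (f - partial_sum (fun l => L2_dot f (psi l) *: dual_psi l) J))
      @ totally --> 0%E;
  pairing_L2 : forall (f : L2 mOmega) l,
    pairing (regular_distribution f) l = L2_dot f (psi l)
}.

Arguments pairing {R d Omega mOmega} _ _ _.

Section BesovSpaces.
Context (R : realType) (d : nat) (Omega : set 'rV[R]_d).
Context (mOmega : lebesgue_measurable Omega) (W : wavelet_basis mOmega).
Implicit Types (s p : R) (c : windex W -> R) (u : test_function Omega -> R).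

(* u = \sum_l c_l dual_psi_l, unconditionally, in the sense of distributions *)
Definition wavelet_sum c u : Prop :=
  forall phi : test_function Omega,
    partial_sum (fun l => c l * regular_distribution (dual_psi l) phi)
      @ totally --> u phi.

Definition besov_sum s p c : \bar R :=
  \esum_(l in [set: windex W])
    (2 `^ (p * (s + d%:R * (2^-1 - p^-1)) * (scale l)%:R) * `|c l| `^ p)%:E.

(* As usual for wavelet characterizations: the distributions that are the sum of
   their wavelet series, with weighted p-summable coefficients. *)
Definition besov s p : set (test_function Omega -> R) :=
  [set u | [/\ is_distribution u,
               wavelet_sum (pairing W u) u &
               (besov_sum s p (pairing W u) < +oo)%E]].

Definition besov_norm s p u : \bar R :=
  if u \in besov s p then (besov_sum s p (pairing W u) `^ p^-1)%E else +oo%E.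

(* Together with [wavelet_sum] in [besov], this makes the map from u to its
   wavelet coefficients a linear isomorphism of B^s_p onto the weighted l_p
   space: a given family c with finite [besov_sum] is the coefficient family of
   an element of B^s_p, which is unique since it is the sum of its series. *)
Definition suitable s p : Prop :=
  forall c, (besov_sum s p c < +oo)%E ->
    exists2 u, besov s p u & forall l, pairing W u l = c l.

Definition linear_on_besov s p
    (F : (test_function Omega -> R) -> L2 mOmega) : Prop :=
  forall (a : R) u w, besov s p u -> besov s p w ->
    L2_eq (F (a *: u + w)) (a *: F u + F w).

Definition continuous_on_besov s p
    (F : (test_function Omega -> R) -> L2 mOmega) : Prop :=
  forall u, besov s p u -> forall e : R, 0 < e -> exists2 eta : R, 0 < eta &
    forall w, besov s p w -> (besov_norm s p (w - u)%R < eta%:E)%E ->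
      (L2_norm (F w - F u)%R < e%:E)%E.

Definition continuously_embedded s p s' p' : Prop :=
  besov s p `<=` besov s' p' /\
  exists C : R, forall u, besov s p u ->
    (besov_norm s' p' u <= C%:E * besov_norm s p u)%E.

Definition min_norm_solution sD pD sR pR
    (F : (test_function Omega -> R) -> L2 mOmega) (v : L2 mOmega) u : Prop :=
  [/\ besov sR pR u, L2_eq (F u) v &
      forall w, besov sD pD w -> L2_eq (F w) v ->
        (besov_norm sR pR u <= besov_norm sR pR w)%E].

Definition tikhonov sR pR (F : (test_function Omega -> R) -> L2 mOmega)
    (alpha : R) (vdelta : L2 mOmega) u : \bar R :=
  (L2_norm (F u - vdelta)%R ^+ 2 + alpha%:E * besov_norm sR pR u `^ pR)%E.

Definition tikhonov_minimizer sD pD sR pR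
    (F : (test_function Omega -> R) -> L2 mOmega)
    (alpha : R) (vdelta : L2 mOmega) u : Prop :=
  besov sD pD u /\
  forall w, besov sD pD w ->
    (tikhonov sR pR F alpha vdelta u <= tikhonov sR pR F alpha vdelta w)%E.

End BesovSpaces.

Definition asymp (R : realType) (A B : R -> R) : Prop :=
  exists c C : R, [/\ 0 < c, 0 < C &
    forall delta, 0 < delta -> c * A delta <= B delta <= C * A delta].

(* Main.v *)
(** Let U be an ultrafilter finer than the filter of right neighbourhoods of 0.
    Comparing the Tikhonov functional at its minimizer and at udag gives
    [||u delta||^pR <= ||udag||^pR + O(delta)] and [F (u delta) --> v].  Along U
    the wavelet coefficients, being bounded, converge to a sequence which Fatou's
    lemma puts in the weighted l_pR; let z be the distribution that it defines.
    A Brezis-Lieb argument shows that [||a + x||^p] and [||a||^p + ||x||^p] are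
    asymptotically equal when x is bounded and tends to 0 coefficientwise.
    - In B^sD_pD, where pD > 1, it makes the p-th power of the norm of a sum of N
      suitable terms [u delta - z] of order N, so that averages of these terms
      tend to 0 in norm.  Their images tend to [v - F z], hence [F z = v].
    - In B^sR_pR, it bounds [||z||^pR + ||u delta - z||^pR] by
      [||udag||^pR + o(1)].  Since udag has minimal norm, z is another
      minimum-norm solution, hence [z = udag] (by strict convexity of
      [t |-> |t|^pR] if [1 < pR]), and [||u delta - z|| --> 0].
    As this holds along every such U, it holds along the filter itself. *)
Require Import Defs.
From mathcomp Require Import all_boot all_order all_algebra.
From mathcomp Require Import finmap.
From mathcomp Require Import all_classical all_reals all_analysis.
From mathcomp Require Import summability measurable_realfun.
From mathcomp Require Import ring lra.

Set Implicit Arguments.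
Unset Strict Implicit.

Import Order.TTheory GRing.Theory Num.Theory.
Import numFieldNormedType.Exports.
Local Open Scope classical_set_scope.
Local Open Scope ring_scope.

(** * Powers of absolute values *)

Lemma powR_continuous_pos (R : realType) (p x : R) :
  0 < x -> {for x, continuous (fun t : R => t `^ p)}.
Proof.
move=> x0; apply: differentiable_continuous; apply/derivable1_diffP.
by apply: derivable_powR; rewrite in_itv/= x0.
Qed.

Lemma powR_le_homo (R : realType) (p x y : R) :
  0 <= p -> 0 <= x -> x <= y -> x `^ p <= y `^ p.
Proof.
by move=> p0 x0 xy; apply: ge0_ler_powR; rewrite ?nnegrE// (le_trans x0).
Qed.

(** The elementary inequality behind the Brezis-Lieb argument. If |a| is at most a small multiple t
    of |b|, continuity of the power at 1 yields the eta term; otherwise both powers are controlled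
    by |a|^p. *)
Lemma powR_normD_close (R : realType) (p eta : R) : 0 < p -> 0 < eta ->
  exists2 C : R, 0 <= C & forall a b : R,
    `| `|a + b| `^ p - `|b| `^ p | <= eta * `|b| `^ p + C * `|a| `^ p.
Proof.
move=> p0 eta0.
have [t [t0 t1 tp tm]] : exists t : R, [/\ 0 < t, t < 1,
    (1 + t) `^ p <= 1 + eta & 1 - eta <= (1 - t) `^ p].
  have c1 : (t `^ p) @[t --> (1 : R)] --> (1 : R).
    have := @powR_continuous_pos R p 1 ltr01.
    by rewrite /prop_for /continuous_at /= powR1.
  move/cvgrPdist_le : c1 => /(_ _ eta0)/nbhs_ballP[r /= r0 rP].
  have [s0 s1 sr] : [/\ 0 < Num.min (r / 2) (1 / 2), Num.min (r / 2) (1 / 2) < 1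
      & Num.min (r / 2) (1 / 2) < r].
    by rewrite lt_min !gt_min; split; lra.
  exists (Num.min (r / 2) (1 / 2)); move: (Num.min _ _) s0 s1 sr => s s0 s1 sr.
  have Pp : `|1 - (1 + s) `^ p| <= eta.
    apply: rP; rewrite /ball/= (_ : 1 - (1 + s) = - s); last by ring.
    by rewrite normrN gtr0_norm.
  have Pm : `|1 - (1 - s) `^ p| <= eta.
    apply: rP; rewrite /ball/= (_ : 1 - (1 - s) = s); last by ring.
    by rewrite gtr0_norm.
  split => //; [move: Pp|move: Pm]; rewrite ler_norml => /andP[]; lra.
(* When |a| > t |b|, both |a + b| and |b| are at most (1 + 1/t) |a|. *)
exists ((1 + t^-1) `^ p); first exact: powR_ge0.
move=> a b.
have pos (x : R) : 0 <= `|x| `^ p by exact: powR_ge0.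
have mono (x y : R) : 0 <= x -> x <= y -> x `^ p <= y `^ p.
  exact/powR_le_homo/ltW.
have [ab|ba] := leP `|a| (t * `|b|).
  have : `|a + b| `^ p <= (1 + eta) * `|b| `^ p.
    apply: (@le_trans _ _ (((1 + t) * `|b|) `^ p)).
      by apply: mono => //; rewrite mulrDl mul1r; have := ler_normD a b; lra.
    by rewrite powRM//; [rewrite ler_wpM2r|lra].
  have : (1 - eta) * `|b| `^ p <= `|a + b| `^ p.
    apply: (@le_trans _ _ (((1 - t) * `|b|) `^ p)).
      by rewrite powRM//; [rewrite ler_wpM2r|lra].
    apply: mono => //; first by rewrite mulr_ge0//; lra.
    have := ler_normD (a + b) (- a); rewrite normrN addrAC subrr add0r; lra.
  have : 0 <= (1 + t^-1) `^ p * `|a| `^ p by rewrite mulr_ge0// powR_ge0.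
  rewrite ler_norml => ? ? ?; apply/andP; split; nra.
have bt : `|b| <= t^-1 * `|a| by rewrite mulrC ler_pdivlMr// mulrC ltW.
have ti0 : 0 < t^-1 by rewrite invr_gt0.
have h1 : `|a + b| `^ p <= (1 + t^-1) `^ p * `|a| `^ p.
  rewrite -powRM//; last by lra.
  by apply: mono => //; rewrite mulrDl mul1r; have := ler_normD a b; lra.
have h2 : `|b| `^ p <= (1 + t^-1) `^ p * `|a| `^ p.
  rewrite -powRM//; last by lra.
  by apply: mono => //; rewrite mulrDl mul1r; have := normr_ge0 a; lra.
have := pos b; have := pos (a + b).
have : 0 <= eta * `|b| `^ p by rewrite mulr_ge0// ltW.
by rewrite ler_norml => ? ? ?; apply/andP; split; lra.
Qed.

(** Strict convexity, by the mean value theorem on both halves of the interval between the absolute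
    values: t^(p - 1) is strictly increasing. If the absolute values agree, then y = - x and the
    left side is 0. *)
Lemma powR_norm_midpoint (R : realType) (p x y : R) : 1 < p -> x != y ->
  2 * `|2^-1 * (x + y)| `^ p < `|x| `^ p + `|y| `^ p.
Proof.
move=> p1 xy.
have p0 : 0 < p by lra.
have mono (a b : R) : 0 <= a -> a <= b -> a `^ p <= b `^ p.
  exact/powR_le_homo/ltW.
have pos (a : R) : 0 <= `|a| `^ p by exact: powR_ge0.
have half : `|2^-1 * (x + y)| <= 2^-1 * (`|x| + `|y|).
  by rewrite normrM gtr0_norm// ler_wpM2l// ler_normD.
have strict (a b : R) : 0 <= a -> a < b ->
    2 * (2^-1 * (a + b)) `^ p < a `^ p + b `^ p.
  rewrite le_eqVlt => /predU1P[<- b0|a0 ab].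
    (* At the endpoint 0, which [powR_continuous_pos] does not cover, the claim reduces to 2 *
       2^(-p) < 1. *)
    rewrite add0r powR0 ?gt_eqF// add0r powRM//; last exact: ltW.
    rewrite mulrA -[ltRHS]mul1r ltr_pM2r ?powR_gt0//.
    have h : (2^-1 : R) `^ (p - 1) < 1 `^ (p - 1).
      by apply: gt0_ltr_powR; rewrite ?nnegrE; lra.
    rewrite -(@mulr_powRB1 _ (2^-1) p)//.
    rewrite powR1 in h; lra.
  set m := 2^-1 * (a + b).
  have [am mb] : a < m /\ m < b by rewrite /m; split; lra.
  have der (t : R) : 0 < t ->
      is_derive t 1 (fun t : R => t `^ p) (p * t `^ (p - 1)).
    by move=> t0; exact: is_derive1_powR.
  have [c c1 E1] : exists2 c, c \in `]a, m[ &
      m `^ p - a `^ p = (p * c `^ (p - 1)) * (m - a).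
    apply: (@MVT _ (fun t : R => t `^ p) (fun t => p * t `^ (p - 1))) => //.
      by move=> t; rewrite in_itv/= => /andP[at_ _]; apply: der; lra.
    apply: continuous_in_subspaceT => t; rewrite inE/= in_itv/= => /andP[at_ _].
    by apply: powR_continuous_pos; lra.
  have [e e1 E2] : exists2 c, c \in `]m, b[ &
      b `^ p - m `^ p = (p * c `^ (p - 1)) * (b - m).
    apply: (@MVT _ (fun t : R => t `^ p) (fun t => p * t `^ (p - 1))) => //.
      by move=> t; rewrite in_itv/= => /andP[at_ _]; apply: der; lra.
    apply: continuous_in_subspaceT => t; rewrite inE/= in_itv/= => /andP[at_ _].
    by apply: powR_continuous_pos; lra.
  move: c1 e1; rewrite !in_itv/= => /andP[c1 c2] /andP[e1 e2].
  have ce : c `^ (p - 1) < e `^ (p - 1).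
    by apply: gt0_ltr_powR; rewrite ?nnegrE; lra.
  have bm : b - m = m - a by rewrite /m; lra.
  have : (p * c `^ (p - 1)) * (m - a) < (p * e `^ (p - 1)) * (m - a).
    by rewrite ltr_pM2r ?ltr_pM2l//; lra.
  rewrite bm in E2; lra.
have [le_|lt_|eq_] := ltgtP `|x| `|y|.
- have := strict _ _ (normr_ge0 x) le_; have := mono _ _ (normr_ge0 _) half; lra.
- have := strict _ _ (normr_ge0 y) lt_; have := mono _ _ (normr_ge0 _) half.
  rewrite (addrC `|y|); lra.
- have -> : x + y = 0.
    move: (eq_) => /eqP; rewrite eqr_norm2 (negPf xy)/= => /eqP ->.
    by rewrite addNr.
  rewrite mulr0 normr0 powR0 ?gt_eqF// mulr0.
  rewrite eq_ -mulr2n mulrn_wgt0// powR_gt0// normr_gt0.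
  apply: contraNneq xy => y0; move/eqP: eq_; rewrite y0 normr0 normr_eq0.
  by move=> /eqP ->.
Qed.

(** * Unconditional sums *)

Lemma esum_scale_le (R : realType) (T : choiceType) (A : set T) (c : R)
    (a : T -> R) : 0 <= c -> (forall l, 0 <= a l) ->
  (\esum_(l in A) (c * a l)%:E <= c%:E * \esum_(l in A) (a l)%:E)%E.
Proof.
move=> c0 a0; apply: ge_ereal_sup => _ [X [finX XA] <-].
under eq_fsbigr do rewrite EFinM.
rewrite -ge0_mule_fsumr; last by move=> l; rewrite lee_fin.
rewrite lee_wpmul2l ?lee_fin//.
by apply: esum_ge; exists X.
Qed.

Lemma esum_setID (R : realType) (T : choiceType) (X : set T) (a : T -> R) :
  (forall l, 0 <= a l) ->
  (\esum_(l in [set: T]) (a l)%:E =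
   \esum_(l in X) (a l)%:E + \esum_(l in ~` X) (a l)%:E)%E.
Proof.
by move=> a0; rewrite (esumID X) ?setTI// => l _; rewrite lee_fin.
Qed.

Lemma esum_finite (R : realType) (T : choiceType) (X : set T) (a : T -> R) :
  finite_set X -> (forall l, 0 <= a l) ->
  (\esum_(l in X) (a l)%:E = (\sum_(l <- fset_set X) a l)%:E)%E.
Proof.
move=> finX a0; rewrite -[in LHS](set_mem_set X) esum_fset ?set_mem_set//.
  by rewrite fsbig_finite// sumEFin.
by move=> l _; rewrite lee_fin.
Qed.

Lemma near_all_seq (T : eqType) (I : Type) (U : set_system I) (FU : Filter U)
    (P : I -> T -> Prop) (s : seq T) :
  (forall l, \forall i \near U, P i l) ->
  \forall i \near U, forall l, l \in s -> P i l.
Proof.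
move=> UP; elim: s => [|x s IH]; first by apply: filterE => i l.
apply: filterS2 (UP x) IH => i Px Ps l.
by rewrite inE => /predU1P[->//|/Ps].
Qed.

Lemma div3_shrink (R : realType) (e N : R) : 0 < e -> 0 <= N ->
  e / (3 * (N + 1)) * N <= e / 3.
Proof.
move=> e0 N0; rewrite mulrAC ler_pdivrMr; last by lra.
have -> : e / 3 * (3 * (N + 1)) = e * (N + 1) by field.
nra.
Qed.

(** Dominated comparison along an arbitrary filter. A finite set X carries the sum of k up to a
    small tail. On X the termwise estimate is used finitely often; off X the domination is used,
    where h has bounded sum and k a small one. *)
Lemma esum_le_near (R : realType) (T : choiceType) (I : Type)
    (U : set_system I) (FU : Filter U) (f g h : I -> T -> R) (k : T -> R)
    (M : R) :
  (forall i l, 0 <= f i l) -> (forall i l, 0 <= g i l) ->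
  (forall i l, 0 <= h i l) -> (forall l, 0 <= k l) ->
  (\esum_(l in [set: T]) (k l)%:E < +oo)%E ->
  (\forall i \near U, (\esum_(l in [set: T]) (h i l)%:E <= M%:E)%E) ->
  (forall eta : R, 0 < eta -> exists2 C : R, 0 <= C &
     forall i l, f i l <= g i l + eta * h i l + C * k l) ->
  (forall l (e : R), 0 < e -> \forall i \near U, f i l <= g i l + e) ->
  forall e : R, 0 < e -> \forall i \near U,
    (\esum_(l in [set: T]) (f i l)%:E <=
     \esum_(l in [set: T]) (g i l)%:E + e%:E)%E.
Proof.
move=> f0 g0 h0 k0 koo hM cmp cvg e e0.
have M0 : 0 < `|M| + 1 by rewrite ltr_wpDl.
(* The error e is split in three: eta times the bound on h, C times the tail of k, and the terms in
   X. Adding 1 to |M|, C and N keeps the denominators positive. *)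
have eta0 : 0 < e / (3 * (`|M| + 1)) by rewrite divr_gt0// mulr_gt0.
have [C C0 fC] := cmp _ eta0.
set eta := e / _ in eta0 fC.
have C10 : 0 < C + 1 by rewrite ltr_wpDl.
have e2 : 0 < e / (3 * (C + 1)) by rewrite divr_gt0// mulr_gt0.
have kfin : (\esum_(l in [set: T]) (k l)%:E \is a fin_num)%E.
  by rewrite ge0_fin_numE// esum_ge0// => l _; rewrite lee_fin.
have [_ [X [finX _] <-] kX] := ub_ereal_sup_adherent e2 kfin.
have tail : (\esum_(l in ~` X) (k l)%:E <= (e / (3 * (C + 1)))%:E)%E.
  have XT := esum_setID X k0.
  have Xfin : (\esum_(l in X) (k l)%:E \is a fin_num)%E.
    rewrite ge0_fin_numE; last by rewrite esum_ge0// => l _; rewrite lee_fin.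
    apply: le_lt_trans koo; rewrite XT.
    by rewrite leeDl// esum_ge0// => l _; rewrite lee_fin.
  have : (\esum_(l in [set: T]) (k l)%:E - (e / (3 * (C + 1)))%:E <
          \esum_(l in X) (k l)%:E)%E.
    by rewrite (esum_finite finX k0) -sumEFin -fsbig_finite.
  by rewrite lteBlDr// XT lteD2lE// => /ltW.
(* N is the cardinality of X: the termwise error is summed over X. *)
have [N N0 XN] : exists2 N : R, 0 <= N & (\esum_(l in X) 1%:E = N%:E)%E.
  by exists (\sum_(l <- fset_set X) 1); [exact: sumr_ge0|exact: esum_finite].
have N10 : 0 < N + 1 by rewrite ltr_wpDl.
have e1 : 0 < e / (3 * (N + 1)) by rewrite divr_gt0// mulr_gt0.
have hX := @near_all_seq T I U FU (fun i l => f i l <= g i l + e / (3 * (N + 1)))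
  (fset_set X) (fun l => cvg l _ e1).
apply: filterS2 hM hX => i hM fX.
rewrite (esum_setID X (f0 i)).
rewrite (esum_setID X (g0 i)).
have p1 : (\esum_(l in X) (f i l)%:E <=
    \esum_(l in X) (g i l)%:E + (e / 3)%:E)%E.
  apply: (@le_trans _ _
    (\esum_(l in X) ((g i l)%:E + (e / (3 * (N + 1)) * 1)%:E))%E).
    apply: le_esum => l Xl; rewrite -EFinD lee_fin mulr1.
    by apply: fX; rewrite in_fset_set// inE.
  rewrite esumD//; [|by move=> l _; rewrite lee_fin|
                     by move=> l _; rewrite lee_fin mulr1 ltW].
  rewrite leeD2l//; apply: le_trans (esum_scale_le _ _ _) _ => //.
    exact: ltW.
  by rewrite XN -EFinM lee_fin div3_shrink.
have p2 : (\esum_(l in ~` X) (f i l)%:E <=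
    \esum_(l in ~` X) (g i l)%:E + ((e / 3)%:E + (e / 3)%:E))%E.
  apply: (@le_trans _ _
    (\esum_(l in ~` X) ((g i l)%:E + ((eta * h i l)%:E + (C * k l)%:E)))%E).
    by apply: le_esum => l _; rewrite -!EFinD lee_fin addrA.
  have eh l : (0 <= (eta * h i l)%:E)%E by rewrite lee_fin mulr_ge0// ltW.
  have ck l : (0 <= (C * k l)%:E)%E by rewrite lee_fin mulr_ge0.
  rewrite esumD//; [|by move=> l _; rewrite lee_fin|
                     by move=> l _; rewrite adde_ge0].
  rewrite esumD//; rewrite leeD2l// leeD//.
    apply: le_trans (esum_scale_le _ _ _) _ => //; first exact: ltW.
    have hX' : (\esum_(l in ~` X) (h i l)%:E <= `|M|%:E)%E.
      apply: (@le_trans _ _ (\esum_(l in [set: T]) (h i l)%:E)%E).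
        rewrite (esum_setID X (h0 i)).
        by rewrite leeDr// esum_ge0// => l _; rewrite lee_fin.
      by apply: le_trans hM _; rewrite lee_fin ler_norm.
    apply: (@le_trans _ _ (eta%:E * `|M|%:E)%E).
      by rewrite lee_wpmul2l// lee_fin ltW.
    by rewrite -EFinM lee_fin div3_shrink.
  apply: le_trans (esum_scale_le _ _ _) _ => //.
  apply: (@le_trans _ _ (C%:E * (e / (3 * (C + 1)))%:E)%E).
    by rewrite lee_wpmul2l.
  by rewrite -EFinM lee_fin mulrC div3_shrink.
apply: le_trans (leeD p1 p2) _.
rewrite addeACA leeD2l// -!EFinD lee_fin; lra.
Qed.

(** * Weighted l_p sums *)

(** [besov_sum] for general weights. The p-th power of the norm is kept because Brezis-Lieb
    estimates are additive in it, and because the norm is only a quasi-norm if p < 1. *)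
Definition wsum (R : realType) (T : choiceType) (p : R) (w a : T -> R) : \bar R :=
  \esum_(l in [set: T]) (w l * `|a l| `^ p)%:E.

Section WeightedSums.
Context (R : realType) (T : choiceType) (p : R) (w : T -> R).
Hypotheses (p0 : 0 < p) (w0 : forall l, 0 < w l).

Let term_ge0 (a : T -> R) l : 0 <= w l * `|a l| `^ p.
Proof. by rewrite mulr_ge0 ?powR_ge0// ltW. Qed.

Lemma wsum_ge0 (a : T -> R) : (0 <= wsum p w a)%E.
Proof. by apply: esum_ge0 => l _; rewrite lee_fin. Qed.

Lemma wsum_term (a : T -> R) l : ((w l * `|a l| `^ p)%:E <= wsum p w a)%E.
Proof.
apply: esum_ge; exists [set l]; last by rewrite fsbig_set1.
by split => //; exact: finite_set1.
Qed.

Lemma wsum0 : wsum p w (fun=> 0) = 0%E.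
Proof.
by apply: esum1 => l _; rewrite normr0 powR0 ?gt_eqF// mulr0.
Qed.

Lemma wsumZ_le (c : R) (a : T -> R) :
  (wsum p w (fun l => c * a l)%R <= (`|c| `^ p)%:E * wsum p w a)%E.
Proof.
rewrite (_ : wsum _ _ _ =
    \esum_(l in [set: T]) (`|c| `^ p * (w l * `|a l| `^ p))%:E)%E.
  by apply: esum_scale_le => //; exact: powR_ge0.
by apply: eq_esum => l _; rewrite normrM powRM// mulrCA.
Qed.

(** A substitute for the triangle inequality, valid also for p < 1: [powR_normD_close] with eta = 1,
    whence the factor 2. *)
Lemma wsumD_le : exists2 C : R, 0 <= C & forall a b : T -> R,
  (wsum p w (fun l => a l + b l)%R <= C%:E * wsum p w a + 2%:E * wsum p w b)%E.
Proof.
have [C C0 HC] := powR_normD_close p0 (@ltr01 R).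
exists C => // a b.
apply: (@le_trans _ _ (\esum_(l in [set: T]) (C * (w l * `|a l| `^ p))%:E +
   \esum_(l in [set: T]) (2 * (w l * `|b l| `^ p))%:E)%E); last first.
  by apply: leeD; apply: esum_scale_le.
rewrite -esumD; [|by move=> l _; rewrite lee_fin mulr_ge0..].
apply: le_esum => l _; rewrite -EFinD lee_fin !(mulrCA _ (w l)) -mulrDr.
rewrite ler_wpM2l ?(ltW (w0 l))//.
have := HC (a l) (b l); rewrite ler_norml => /andP[_];  lra.
Qed.

(** The midpoint defect [gap] is nonnegative at every index and positive where a and b differ, so a
    single differing index would push the sum at the midpoint below K. *)
Lemma wsum_strict (a b : T -> R) (K : R) : 1 < p ->
  (wsum p w a <= K%:E)%E -> (wsum p w b <= K%:E)%E ->
  (K%:E <= wsum p w (fun l => 2^-1 * (a l + b l))%R)%E ->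
  forall l, a l = b l.
Proof.
move=> p1 aK bK Kab l0; apply/eqP; apply: contraT => ab.
pose gap l := (w l * `|a l| `^ p + w l * `|b l| `^ p)
    - 2 * (w l * `|2^-1 * (a l + b l)| `^ p).
have mid l : 0 <= gap l.
  rewrite /gap (mulrCA 2) -!mulrDr -mulrBr mulr_ge0 ?(ltW (w0 l))// subr_ge0.
  have [->|ne] := eqVneq (a l) (b l); last exact/ltW/powR_norm_midpoint.
  rewrite (_ : 2^-1 * (b l + b l) = b l); last by field.
  by rewrite mulr2n mulrDl mul1r.
have gap0 : 0 < gap l0.
  rewrite /gap (mulrCA 2) -!mulrDr -mulrBr mulr_gt0// subr_gt0.
  exact: powR_norm_midpoint.
have gapS : ((gap l0)%:E <= \esum_(l in [set: T]) (gap l)%:E)%E.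
  apply: esum_ge; exists [set l0]; last by rewrite fsbig_set1.
  by split => //; exact: finite_set1.
have halfge0 l : 0 <= w l * `|2^-1 * (a l + b l)| `^ p.
  exact: (term_ge0 (fun l => 2^-1 * (a l + b l))).
have E : (wsum p w a + wsum p w b = wsum p w (fun l => 2^-1 * (a l + b l))%R +
    wsum p w (fun l => 2^-1 * (a l + b l))%R +
    \esum_(l in [set: T]) (gap l)%:E)%E.
  rewrite /wsum -!esumD; do ?[by move=> l _; rewrite ?adde_ge0 ?lee_fin ?mid].
  by apply: eq_esum => l _; rewrite -!EFinD /gap; congr EFin; ring.
have : (K%:E + K%:E + (gap l0)%:E <= K%:E + K%:E)%E.
  apply: (@le_trans _ _ (wsum p w a + wsum p w b)%E); last exact: leeD.
  by rewrite E !leeD.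
by rewrite -!EFinD lee_fin; lra.
Qed.

(** The bound is uniform over a ball; this is what makes the coefficients converge along an
    ultrafilter. *)
Lemma wsum_coef_bounded (M : R) (l : T) : exists B : R,
  forall a : T -> R, (wsum p w a <= M%:E)%E -> `|a l| <= B.
Proof.
exists ((M / w l) `^ p^-1) => a aM.
have := le_trans (wsum_term a l) aM; rewrite lee_fin => h.
rewrite -(@powRr1 _ `|a l|)// -(mulfV (lt0r_neq0 p0)) powRrM.
apply: powR_le_homo; rewrite ?powR_ge0// ?invr_ge0; first exact: ltW.
by rewrite ler_pdivlMr// mulrC.
Qed.

(** * Brezis-Lieb estimates along a filter *)

Section AlongFilter.
Context (I : Type) (U : set_system I) (FU : Filter U).

Lemma cvg_wterm (x : I -> T -> R) (a : T -> R) (l : T) :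
  x i l @[i --> U] --> a l ->
  w l * `|x i l| `^ p @[i --> U] --> w l * `|a l| `^ p.
Proof.
move=> xa; apply: cvgMr.
have [al0|al0] := eqVneq (a l) 0; last first.
  apply: (@cvg_comp _ _ _ (fun i => `|x i l|) (fun t => t `^ p)).
    exact: cvg_norm xa.
  by apply: powR_continuous_pos; rewrite normr_gt0.
(* At the limit 0 the continuity of the power is checked by hand, with threshold e^(1/p). *)
rewrite al0 normr0 powR0 ?gt_eqF//.
apply/cvgr0Pnorm_le => e e0.
have e1 : 0 < e `^ p^-1 by exact: powR_gt0.
have := xa; rewrite al0 => /cvgr0Pnorm_le/(_ _ e1); apply: filterS => i h.
rewrite ger0_norm ?powR_ge0//.
rewrite -[leRHS]powRr1 ?(ltW e0)// -(@mulVf _ p) ?gt_eqF// powRrM.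
by apply: powR_le_homo => //; exact: ltW.
Qed.

Variables (x : I -> T -> R) (a : T -> R) (M : R).
Hypotheses (a_fin : (wsum p w a < +oo)%E)
  (x_bnd : \forall i \near U, (wsum p w (x i) <= M%:E)%E)
  (x_cvg0 : forall l, x i l @[i --> U] --> (0 : R)).

Let xa_cvg l : w l * `|a l + x i l| `^ p @[i --> U] --> w l * `|a l| `^ p.
Proof.
apply: (@cvg_wterm (fun i l => a l + x i l)).
by rewrite -[X in _ --> X]addr0; apply: cvgD => //; exact: cvg_cst.
Qed.

(** Upper half of Brezis-Lieb, by [esum_le_near]: [powR_normD_close] puts the small factor eta on
    the bounded [x i] and the large C on the fixed summable [a]. *)
Lemma wsumD_le_near (e : R) : 0 < e -> \forall i \near U,
  (wsum p w (fun l => a l + x i l)%R <= wsum p w a + wsum p w (x i) + e%:E)%E.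
Proof.
move=> e0.
have key : \forall i \near U, (wsum p w (fun l => a l + x i l)%R <=
    \esum_(l in [set: T]) (w l * `|a l| `^ p + w l * `|x i l| `^ p)%:E + e%:E)%E.
  apply: (@esum_le_near R T I U FU (fun i l => w l * `|a l + x i l| `^ p)
    (fun i l => w l * `|a l| `^ p + w l * `|x i l| `^ p)
    (fun i l => w l * `|x i l| `^ p) (fun l => w l * `|a l| `^ p) M) => //.
  - by move=> i l; exact: (term_ge0 (fun l => a l + x i l)).
  - by move=> i l; rewrite addr_ge0.
  - move=> eta eta0; have [C C0 HC] := powR_normD_close p0 eta0.
    exists C => // i l; rewrite -mulrDr !(mulrCA _ (w l)) -!mulrDr.
    rewrite ler_wpM2l ?(ltW (w0 l))//.
    have := HC (a l) (x i l); rewrite ler_norml => /andP[_].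
    by have := powR_ge0 `|a l| p; lra.
  - move=> l e' e'0.
    have /cvgrPdist_le/(_ _ e'0) := @xa_cvg l; apply: filterS => i.
    by rewrite ler_norml => /andP[h _]; have := term_ge0 (x i) l; lra.
apply: filterS key => i; congr (_ <= _ + _)%E.
by rewrite /wsum -esumD// => l _; rewrite lee_fin.
Qed.

(** Lower half of Brezis-Lieb, with the same kind of domination. *)
Lemma wsumD_ge_near (e : R) : 0 < e -> \forall i \near U,
  (wsum p w a + wsum p w (x i) <= wsum p w (fun l => a l + x i l)%R + e%:E)%E.
Proof.
move=> e0.
have key : \forall i \near U,
    (\esum_(l in [set: T]) (w l * `|a l| `^ p + w l * `|x i l| `^ p)%:E <=
     wsum p w (fun l => a l + x i l)%R + e%:E)%E.
  apply: (@esum_le_near R T I U FU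
    (fun i l => w l * `|a l| `^ p + w l * `|x i l| `^ p)
    (fun i l => w l * `|a l + x i l| `^ p)
    (fun i l => w l * `|x i l| `^ p) (fun l => w l * `|a l| `^ p) M) => //.
  - by move=> i l; rewrite addr_ge0.
  - by move=> i l; exact: (term_ge0 (fun l => a l + x i l)).
  - move=> eta eta0; have [C C0 HC] := powR_normD_close p0 eta0.
    (* The extra 1 absorbs the term of [a], which now stands on the left. *)
    exists (C + 1) => [|i l]; first by rewrite addr_ge0.
    rewrite -mulrDr !(mulrCA _ (w l)) -!mulrDr.
    rewrite ler_wpM2l ?(ltW (w0 l))//.
    by have := HC (a l) (x i l); rewrite ler_norml => /andP[]; lra.
  - move=> l e' e'0.
    have e2 : 0 < e' / 2 by lra.
    have /cvgrPdist_le/(_ _ e2) := @xa_cvg l.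
    have /cvgrPdist_le/(_ _ e2) := @cvg_wterm x (fun=> 0) l (@x_cvg0 l).
    rewrite normr0 powR0 ?gt_eqF// mulr0.
    apply: filterS2 => i; rewrite !ler_norml => /andP[? _] /andP[_ ?]; lra.
apply: filterS key => i; congr (_ <= _ + _)%E.
by rewrite /wsum -esumD// => l _; rewrite lee_fin.
Qed.

End AlongFilter.

(** Finite partial sums pass to the limit along U, and the whole sum is their supremum. *)
Lemma wsum_fatou (I : Type) (U : set_system I) (PU : ProperFilter U)
    (x : I -> T -> R) (a : T -> R) (M : R) :
  (forall l, x i l @[i --> U] --> a l) ->
  (\forall i \near U, (wsum p w (x i) <= M%:E)%E) ->
  (wsum p w a <= M%:E)%E.
Proof.
move=> xa xM; apply: ge_ereal_sup => _ [X [finX _] <-].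
rewrite fsbig_finite// sumEFin lee_fin.
apply: (@cvgr_to_le _ U PU R
  (fun i => \sum_(l <- fset_set X) w l * `|x i l| `^ p)).
  by apply: cvg_big => [|l _]; [exact: add_continuous|exact: cvg_wterm].
apply: filterS xM => i xiM; rewrite -lee_fin -sumEFin -fsbig_finite//.
by apply: le_trans xiM; apply: esum_ge; exists X.
Qed.

End WeightedSums.

(** * The norm of L_2 *)

Section L2Norm.
Context (R : realType) (d : nat) (Omega : set 'rV[R]_d).
Context (mOmega : lebesgue_measurable Omega).
Implicit Types (f g h : L2 mOmega).

Definition L2nrm f : R := fine (L2_norm f).

Lemma L2nrmE f : (L2nrm f)%:E = L2_norm f.
Proof. exact: finite_norm_fine. Qed.

Lemma L2nrm_ge0 f : 0 <= L2nrm f.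
Proof. by rewrite -lee_fin L2nrmE; exact: Lnorm_ge0. Qed.

Lemma L2nrmD f g : L2nrm (f + g) <= L2nrm f + L2nrm g.
Proof. exact: ler_LnormD. Qed.

Lemma L2nrmZ (a : R) f : L2nrm (a *: f) = `|a| * L2nrm f.
Proof.
apply: EFin_inj; rewrite EFinM !L2nrmE; exact: (@LnormZ _ _ _ _ _ (lee1n 2) f a).
Qed.

Lemma L2nrmN f : L2nrm (- f) = L2nrm f.
Proof. by rewrite -scaleN1r L2nrmZ normrN1 mul1r. Qed.

Lemma L2nrmBC f g : L2nrm (f - g) = L2nrm (g - f).
Proof. by rewrite -L2nrmN opprB. Qed.

Lemma L2nrm_triangle g f h : L2nrm (f - h) <= L2nrm (f - g) + L2nrm (g - h).
Proof. by rewrite -(subrKA g); exact: L2nrmD. Qed.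

(** Elements of [L2] are functions and not classes; equality in L_2(Omega) is handled below as zero
    distance. *)
Lemma L2nrm_sub_eq0 f g : L2_eq f g <-> L2nrm (f - g) = 0.
Proof.
split => [fg|/fine_Lnormr_eq0]; last first.
  apply: filterS => x /(_ I) /= /eqP; rewrite subr_eq0 => /eqP h _; exact: h.
apply: EFin_inj; rewrite L2nrmE /L2_norm unlock.
rewrite (_ : (\int[_]_x _)%E = 0%E) ?poweR0r ?invr_eq0//.
rewrite -[RHS](@integral0 _ _ _ (lebesgue_on mOmega) setT).
apply: ae_eq_integral => //.
- have mfg : measurable_fun setT (f - g : _ -> R) by [].
  have m1 : measurable_fun setT (fun x => `|(f - g : _ -> R) x|).
    exact: measurableT_comp mfg.
  have m2 := measurableT_comp (@measurable_powR R 2) m1.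
  by move/measurable_EFinP : m2.
- apply: filterS fg => x /(_ I) fgx _.
  change ((`|f x - g x| `^ 2)%:E = 0%E).
  by rewrite fgx subrr normr0 powR0.
Qed.

Lemma L2nrm_eql f f' g : L2_eq f f' -> L2nrm (f - g) = L2nrm (f' - g).
Proof.
move=> /L2nrm_sub_eq0 ff'; apply/eqP; rewrite eq_le.
have := L2nrm_triangle f' f g; have := L2nrm_triangle f f' g.
by rewrite L2nrmBC ff' (L2nrmBC f') ff' !add0r => -> ->.
Qed.

End L2Norm.

(** * Linear structure of Besov spaces *)

#[local] Existing Instance totally_filter.

Section BesovLinear.
Context (R : realType) (d : nat) (Omega : set 'rV[R]_d).
Context (mOmega : lebesgue_measurable Omega) (W : wavelet_basis mOmega).
Implicit Types (s p a : R) (c : windex W -> R) (u : test_function Omega -> R).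

Definition bweight s p (l : windex W) : R :=
  2 `^ (p * (s + d%:R * (2^-1 - p^-1)) * (scale l)%:R).

Lemma bweight_gt0 s p l : 0 < bweight s p l.
Proof. exact: powR_gt0. Qed.

Lemma besov_sumE s p c : besov_sum s p c = wsum p (bweight s p) c.
Proof. by []. Qed.

Lemma wavelet_sum_unique c u u' :
  wavelet_sum c u -> wavelet_sum c u' -> u = u'.
Proof.
move=> cu cu'; apply/funext => phi.
exact: (cvg_unique (@Rhausdorff R) (cu phi) (cu' phi)).
Qed.

Lemma wavelet_sum_lin a c c' u u' :
  wavelet_sum c u -> wavelet_sum c' u' ->
  wavelet_sum (fun l => a * c l + c' l) (a *: u + u').
Proof.
move=> cu cu' phi.
have E J : partial_sum (fun l => (a * c l + c' l) *
      regular_distribution (dual_psi l) phi) J =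
    a * partial_sum (fun l => c l * regular_distribution (dual_psi l) phi) J +
    partial_sum (fun l => c' l * regular_distribution (dual_psi l) phi) J.
  rewrite /partial_sum mulr_sumr -big_split/=.
  by apply: eq_bigr => l _; rewrite mulrDl mulrA.
under eq_cvg do rewrite E.
by apply: cvgD; [apply: cvgMr; exact: cu|exact: cu'].
Qed.

Section Smoothness.
Variables (s p : R).
Hypotheses (p0 : 0 < p) (hW : suitable W s p).

Lemma besov_of_coef c : (besov_sum s p c < +oo)%E ->
  exists u, [/\ besov W s p u, wavelet_sum c u & forall l, pairing W u l = c l].
Proof.
move=> /hW[u uB uc]; exists u; split => //.
by have [_ + _] := uB; rewrite (_ : pairing W u = c)//; apply/funext.
Qed.

(** [pairing] is not assumed linear. By [suitable], some z in the space has the combined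
    coefficients; z and [a *: u + u'] are sums of the same wavelet series, hence equal. *)
Lemma besov_lin a u u' : besov W s p u -> besov W s p u' ->
  besov W s p (a *: u + u') /\
  forall l, pairing W (a *: u + u') l = a * pairing W u l + pairing W u' l.
Proof.
move=> [_ su fu] [_ su' fu'].
have [C C0 HC] := wsumD_le p0 (bweight_gt0 s p).
have fin : (besov_sum s p (fun l => a * pairing W u l + pairing W u' l)%R < +oo)%E.
  apply: le_lt_trans (HC (fun l => a * pairing W u l) (pairing W u')) _.
  rewrite lte_add_pinfty// lte_mul_pinfty// ?lee_fin//.
  - apply: le_lt_trans (wsumZ_le _ (bweight_gt0 s p) a (pairing W u)) _.
    rewrite lte_mul_pinfty// lee_fin; exact: powR_ge0.
have [z [zB zs zc]] := besov_of_coef fin.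
have <- : z = a *: u + u'.
  by apply: wavelet_sum_unique zs _; apply: wavelet_sum_lin.
by split.
Qed.

Lemma besov0 : besov W s p 0 /\ forall l, pairing W 0 l = 0.
Proof.
have fin : (besov_sum s p (fun _ : windex W => 0%R) < +oo)%E.
  by rewrite besov_sumE wsum0.
have [z [zB zs zc]] := besov_of_coef fin.
suff <- : z = 0 by split.
apply: wavelet_sum_unique zs _ => phi.
have E J : partial_sum (fun l => 0 *
      regular_distribution (@dual_psi _ _ _ _ W l) phi) J = 0.
  by rewrite /partial_sum big1// => l _; rewrite mul0r.
under eq_cvg do rewrite E.
exact: cvg_cst.
Qed.

Lemma besovZ a u : besov W s p u ->
  besov W s p (a *: u) /\ forall l, pairing W (a *: u) l = a * pairing W u l.
Proof.
move=> uB; have [B0 c0] := besov0; have [] := besov_lin a uB B0.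
by rewrite addr0 => ? h; split => // l; rewrite h c0 addr0.
Qed.

Lemma besovD u u' : besov W s p u -> besov W s p u' ->
  besov W s p (u + u') /\
  forall l, pairing W (u + u') l = pairing W u l + pairing W u' l.
Proof.
move=> uB uB'; have [] := besov_lin 1 uB uB'.
by rewrite scale1r => ? h; split => // l; rewrite h mul1r.
Qed.

Lemma besovB u u' : besov W s p u -> besov W s p u' ->
  besov W s p (u - u') /\
  forall l, pairing W (u - u') l = pairing W u l - pairing W u' l.
Proof.
move=> uB uB'; have [] := besov_lin (-1) uB' uB.
rewrite scaleN1r addrC => ? h; split => // l.
by rewrite h mulN1r addrC.
Qed.

Lemma besov_ext u u' : besov W s p u -> besov W s p u' ->
  (forall l, pairing W u l = pairing W u' l) -> u = u'.
Proof.
move=> [_ su _] [_ su' _] /funext e; rewrite e in su.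
exact: wavelet_sum_unique su su'.
Qed.

(** The p-th power of the norm as a real number. It is meaningful only on the Besov space, since
    [fine] sends +oo to 0. *)
Definition bsum u : R := fine (besov_sum s p (pairing W u)).

Lemma bsumE u : besov W s p u -> wsum p (bweight s p) (pairing W u) = (bsum u)%:E.
Proof.
move=> [_ _ fu]; rewrite /bsum fineK// ge0_fin_numE//.
exact/wsum_ge0/bweight_gt0.
Qed.

Lemma bsum_ge0 u : 0 <= bsum u.
Proof. by rewrite /bsum fine_ge0//; apply/wsum_ge0/bweight_gt0. Qed.

Lemma besov_normE u : besov W s p u -> besov_norm W s p u = (bsum u `^ p^-1)%:E.
Proof.
by move=> uB; rewrite /besov_norm mem_set// besov_sumE bsumE.
Qed.

Lemma besov_norm_powR u : besov W s p u ->
  (besov_norm W s p u `^ p)%E = (bsum u)%:E.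
Proof.
move=> uB; rewrite (besov_normE uB) poweR_EFin -powRrM mulVf ?gt_eqF//.
by rewrite powRr1// bsum_ge0.
Qed.

End Smoothness.
End BesovLinear.

Arguments bweight {R d Omega mOmega} W s p l.
Arguments bweight_gt0 {R d Omega mOmega} W s p l.

(** * Linear operators on Besov spaces *)

(** The role of 1 < p in the Banach-Saks argument: N^p outgrows every multiple of N. *)
Lemma nat_powR_gt (R : realType) (p B : R) : 1 < p -> 0 < B ->
  exists N : nat, B * N.+1%:R < N.+1%:R `^ p.
Proof.
move=> p1 B0; have q0 : 0 < p - 1 by lra.
exists (Num.truncn (B `^ (p - 1)^-1)).
set N := (Num.truncn _).+1.
have BN : B `^ (p - 1)^-1 < N%:R.
  exact: truncnS_gt.
have N0 : 0 < N%:R :> R by rewrite ltr0n.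
rewrite mulrC -(@mulr_powRB1 _ N%:R p) ?(ltW N0) ?ltr_pM2l//; last by lra.
have -> : B = (B `^ (p - 1)^-1) `^ (p - 1).
  by rewrite -powRrM mulVf ?gt_eqF// powRr1// ltW.
by apply: gt0_ltr_powR; rewrite ?nnegrE ?powR_ge0// ltW.
Qed.

Section LinearOperator.
Context (R : realType) (d : nat) (Omega : set 'rV[R]_d).
Context (mOmega : lebesgue_measurable Omega) (W : wavelet_basis mOmega).
Context (s p : R) (F : (test_function Omega -> R) -> L2 mOmega).
Hypotheses (hW : suitable W s p) (F_linear : linear_on_besov W s p F)
  (F_continuous : continuous_on_besov W s p F).

(** Linearity holds on the Besov space and up to equality almost everywhere, hence the form with a
    vanishing norm. *)
Lemma operatorD u w : besov W s p u -> besov W s p w ->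
  L2nrm (F (u + w) - (F u + F w)) = 0.
Proof.
move=> uB wB; apply/L2nrm_sub_eq0; have := F_linear 1 uB wB.
by rewrite !scale1r.
Qed.

Lemma operator0 : 0 < p -> L2nrm (F 0) = 0.
Proof.
move=> p0; have [B0 _] := besov0 p0 hW; have := operatorD B0 B0.
by rewrite addr0 opprD addrA subrr add0r L2nrmN.
Qed.

Lemma operatorZ (a : R) u : 0 < p -> besov W s p u ->
  L2nrm (F (a *: u) - a *: F u) = 0.
Proof.
move=> p0 uB; have [B0 _] := besov0 p0 hW.
have /L2nrm_sub_eq0 := F_linear a uB B0; rewrite addr0 => h.
apply/eqP; rewrite eq_le L2nrm_ge0 andbT -h -[leRHS]addr0 -(operator0 p0).
have := L2nrm_triangle (a *: F u + F 0) (F (a *: u)) (a *: F u).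
by rewrite [_ + F 0 - _]addrAC subrr add0r.
Qed.

Lemma operatorB u w : besov W s p u -> besov W s p w ->
  L2nrm (F (u - w) - (F u - F w)) = 0.
Proof.
move=> uB wB; have /L2nrm_sub_eq0 := F_linear (-1) wB uB.
by rewrite !scaleN1r [- w + u]addrC [- F w + F u]addrC.
Qed.

Lemma operator_small (e : R) : 0 < p -> 0 < e ->
  exists2 eta : R, 0 < eta &
    forall w, besov W s p w -> bsum W s p w < eta -> L2nrm (F w) < e.
Proof.
move=> p0 e0; have [B0 _] := besov0 p0 hW.
have [eta eta0 H] := F_continuous B0 e0.
(* [bsum] is the p-th power of the norm, so the radius is raised to the power p. *)
exists (eta `^ p); first exact: powR_gt0.
move=> w wB wlt; have h : L2nrm (F w - F 0) < e.
  rewrite -lte_fin L2nrmE; apply: H => //; rewrite subr0 (besov_normE wB) lte_fin.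
  have -> : eta = (eta `^ p) `^ p^-1.
    by rewrite -powRrM mulfV ?gt_eqF// powRr1// ltW.
  by apply: gt0_ltr_powR; rewrite ?invr_gt0 ?nnegrE ?powR_ge0// bsum_ge0.
apply: le_lt_trans h.
by have := L2nrmD (F w - F 0) (F 0); rewrite subrK operator0// addr0.
Qed.

(** * Averages of coefficientwise null families *)

Section BanachSaks.
Context (I : Type) (U : set_system I) (PU : ProperFilter U).
Variables (x : I -> test_function Omega -> R) (g : L2 mOmega) (M : R).
Hypotheses (p1 : 1 < p)
  (xB : \forall i \near U, besov W s p (x i) /\ bsum W s p (x i) <= M)
  (x0 : forall l, pairing W (x i) l @[i --> U] --> (0 : R))
  (xg : forall e : R, 0 < e -> \forall i \near U, L2nrm (F (x i) - g) <= e).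

Let p0 : 0 < p. Proof. exact: lt_trans p1. Qed.

(** Here z is a sum of N of the [x i], chosen one by one. By [wsumD_le_near] with error 1, a term
    far enough along U adds at most M + 1 to [bsum], so the growth is linear in N. *)
Lemma sum_of_terms (e : R) (N : nat) : 0 < e -> exists z,
  [/\ besov W s p z, bsum W s p z <= N%:R * (M + 1) &
      L2nrm (F z - N%:R *: g) <= N%:R * e].
Proof.
move=> e0; elim: N => [|N [z [zB zM zg]]].
  have [B0 c0] := besov0 p0 hW; exists 0; split => //.
    have := bsumE B0; rewrite (_ : pairing W 0 = fun=> 0); last exact/funext.
    by rewrite wsum0// => -[<-]; rewrite mul0r.
  by rewrite scale0r subr0 mul0r operator0.
have xM : \forall i \near U,
    (wsum p (bweight W s p) (pairing W (x i)) <= M%:E)%E.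
  by apply: filterS xB => i [xiB xiM]; rewrite bsumE.
have zfin : (wsum p (bweight W s p) (pairing W z) < +oo)%E by rewrite bsumE// ltry.
have Uf : Filter U by exact: filter_filter.
have near1 := wsumD_le_near p0 (bweight_gt0 W s p) Uf zfin xM x0 (@ltr01 R).
have [i [[xiB xiM] [le1 xig]]] := filter_ex (filterI xB (filterI near1 (xg e0))).
have [zxB zxc] := besovD p0 hW zB xiB.
exists (z + x i); split => //.
  rewrite -lee_fin -bsumE// (_ : pairing W (z + x i) =
    fun l => pairing W z l + pairing W (x i) l); last exact/funext.
  apply: le_trans le1 _; rewrite !bsumE// -!EFinD lee_fin -natr1; lra.
apply: le_trans (L2nrm_triangle (F z + F (x i)) _ _) _.
rewrite operatorD// add0r -natr1 scalerDl scale1r opprD addrACA.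
apply: le_trans (L2nrmD _ _) _; lra.
Qed.

(** An average of N+1 terms has [bsum] at most (M + 1) (N + 1) / (N + 1)^p, which is small for large
    N, while its image stays close to g. Continuity of F at 0 then forces g to vanish. *)
Lemma banach_saks : L2nrm g = 0.
Proof.
apply/eqP; rewrite eq_le L2nrm_ge0 andbT; apply/ler_addgt0Pr => e e0.
have e2 : 0 < e / 2 by lra.
have [eta eta0 small] := operator_small p0 e2.
have M0 : 0 <= M.
  have [i [_ h]] := filter_ex xB; apply: le_trans h; exact: bsum_ge0.
(* With this factor, [nat_powR_gt] gives (M + 1) (N + 1) < eta (N + 1)^p. *)
have B0 : 0 < (M + 1) / eta by rewrite divr_gt0//; lra.
have [N hN] := nat_powR_gt p1 B0.
have [z [zB zM zg]] := sum_of_terms N.+1 e2.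
have N0 : 0 < N.+1%:R :> R by rewrite ltr0n.
pose a : R := N.+1%:R^-1.
have a0 : 0 < a by rewrite invr_gt0.
have [yB yc] := besovZ p0 hW a zB.
have ylt : bsum W s p (a *: z) < eta.
  have h : bsum W s p (a *: z) <= a `^ p * bsum W s p z.
    rewrite -lee_fin EFinM -!bsumE// (_ : pairing W (a *: z) =
      fun l => a * pairing W z l); last exact/funext.
    by have := wsumZ_le p (bweight_gt0 W s p) a (pairing W z); rewrite gtr0_norm.
  apply: le_lt_trans h _; rewrite /a -powR_inv1 ?(ltW N0)// -powRrM mulN1r powRN.
  rewrite mulrC ltr_pdivrMr ?powR_gt0//; apply: le_lt_trans zM _.
  rewrite -ltr_pdivrMl// (_ : eta^-1 * _ = (M + 1) / eta * N.+1%:R)//.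
  ring.
have ysmall := small _ yB ylt.
have yg : L2nrm (F (a *: z) - g) <= e / 2.
  apply: le_trans (L2nrm_triangle (a *: F z) _ _) _; rewrite operatorZ// add0r.
  have -> : a *: F z - g = a *: (F z - N.+1%:R *: g).
    by rewrite scalerBr scalerA /a mulVf ?gt_eqF// scale1r.
  by rewrite L2nrmZ gtr0_norm// /a mulrC ler_pdivrMr// mulrC.
have := L2nrm_triangle (F (a *: z)) g 0; rewrite !subr0 L2nrmBC; lra.
Qed.

End BanachSaks.
End LinearOperator.

(** * Minimum-norm solutions and Tikhonov minimizers *)

(** If A were not in F, the restriction of F to the complement of A would be proper, and an
    ultrafilter finer than it would contain both A and its complement. *)
Lemma filter_of_ultra (T : Type) (F : set_system T) (FF : Filter F) (A : set T) :
  (forall U : set_system T, UltraFilter U -> F `<=` U -> U A) -> F A.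
Proof.
move=> UA; apply: contrapT => nFA.
have PW : ProperFilter (within (~` A) F).
  apply: Build_ProperFilter => h; apply: nFA.
  by apply: (@filterS _ F FF _ A _ h) => x /= nAx; apply: contrapT.
have [U [UU WU]] := ultraFilterLemma PW.
have FU : F `<=` U.
  by move=> B FB; apply: WU; rewrite /within/=; apply: filterS FB.
have nUA : U (~` A) by apply: WU; rewrite /within/=; apply: filterE.
by have [x [? ?]] := filter_ex (filterI (UA U UU FU) nUA).
Qed.

(** By compactness of [-B, B] the image of U has a cluster point, and a cluster point of an
    ultrafilter is a limit. *)
Lemma ultra_cvg_bounded (R : realType) (T : Type) (U : set_system T)
    (UU : UltraFilter U) (f : T -> R) (B : R) :
  (\forall i \near U, `|f i| <= B) -> exists c : R, f i @[i --> U] --> c.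
Proof.
move=> fB.
have : compact `[- B, B]%classic by exact: segment_compact.
have PU : ProperFilter (f @ U) by exact: fmap_proper_filter.
move=> /(_ (f @ U) PU)[].
  by apply: filterS fB => i; rewrite ler_norml /= in_itv.
move=> c [_ cc]; exists c => A Ac.
have [//|UnA] := in_ultra_setVsetC (f @^-1` A) UU.
by have [t [? ?]] := cc (~` A) A UnA Ac.
Qed.

Lemma midpointB (R : realType) (V : lmodType R) (a b v : V) :
  2^-1 *: (a + b) - v = 2^-1 *: ((a - v) + (b - v)).
Proof.
have {1}-> : v = 2^-1 *: (v + v).
  by rewrite -mulr2n -(scaler_nat 2 v) scalerA mulVf// scale1r.
by rewrite -scalerBr opprD addrACA.
Qed.

Section Regularization.
Context (R : realType) (d : nat) (Omega : set 'rV[R]_d).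
Context (mOmega : lebesgue_measurable Omega) (W : wavelet_basis mOmega).
Context (sD pD sR pR : R) (F : (test_function Omega -> R) -> L2 mOmega).
Hypotheses (hpD : 1 < pD) (hpR : 0 < pR)
  (hWD : suitable W sD pD) (hWR : suitable W sR pR)
  (F_linear : linear_on_besov W sD pD F)
  (F_continuous : continuous_on_besov W sD pD F)
  (embedding : continuously_embedded W sR pR sD pD).

Let hpD0 : 0 < pD. Proof. exact: lt_trans hpD. Qed.

Lemma bsumB_le : exists2 C : R, 0 <= C & forall u w,
  besov W sR pR u -> besov W sR pR w ->
  bsum W sR pR (u - w) <= C * bsum W sR pR w + 2 * bsum W sR pR u.
Proof.
have [C C0 HC] := wsumD_le hpR (bweight_gt0 W sR pR).
exists C => // u w uB wB.
have [B1 c1] := besovZ hpR hWR (-1) wB.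
have [B2 c2] := besovB hpR hWR uB wB.
have nw : wsum pR (bweight W sR pR) (pairing W (- 1 *: w)) =
    wsum pR (bweight W sR pR) (pairing W w).
  by apply: eq_esum => l _; rewrite c1 mulN1r normrN.
have := HC (pairing W (- 1 *: w)) (pairing W u).
rewrite (_ : (fun l => _) = pairing W (u - w)); last first.
  by apply/funext => l; rewrite c1 c2 mulN1r addrC.
by rewrite nw !bsumE// -!EFinM -EFinD lee_fin.
Qed.

Lemma bsum_embedding (M : R) : exists M' : R, forall u,
  besov W sR pR u -> bsum W sR pR u <= M -> bsum W sD pD u <= M'.
Proof.
have [sub [C HC]] := embedding.
(* The embedding constant has no prescribed sign, hence its absolute value. *)
exists ((`|C| * M `^ pR^-1) `^ pD) => u uB uM.
have uD := sub _ uB.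
have := HC _ uB; rewrite (besov_normE uB) (besov_normE uD) -EFinM lee_fin => h.
have -> : bsum W sD pD u = (bsum W sD pD u `^ pD^-1) `^ pD.
  by rewrite -powRrM mulVf ?gt_eqF// powRr1// bsum_ge0.
apply: powR_le_homo; rewrite ?powR_ge0// ?(ltW hpD0)//.
apply: le_trans h _; apply: (@le_trans _ _ (`|C| * bsum W sR pR u `^ pR^-1)).
  by rewrite ler_wpM2r ?powR_ge0// ler_norm.
rewrite ler_wpM2l//; apply: powR_le_homo => //; last exact: bsum_ge0.
by rewrite invr_ge0 ltW.
Qed.

Variables (v : L2 mOmega) (udag : test_function Omega -> R).
Hypotheses (hudag : min_norm_solution W sD pD sR pR F v udag)
  (udag_unique : pR <= 1 -> forall w,
     min_norm_solution W sD pD sR pR F v w -> w = udag).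

Let K := bsum W sR pR udag.

Lemma udag_minimal w : besov W sR pR w -> L2_eq (F w) v -> K <= bsum W sR pR w.
Proof.
move=> wB Fw; have [uB _ /(_ w (embedding.1 _ wB) Fw)] := hudag.
rewrite (besov_normE uB) (besov_normE wB) lee_fin => h.
have b1 := bsum_ge0 W sR pR udag; have b2 := bsum_ge0 W sR pR w.
rewrite /K; move: (bsum W sR pR udag) (bsum W sR pR w) b1 b2 h => a b a0 b0 h.
have e (r : R) : 0 <= r -> (r `^ pR^-1) `^ pR = r.
  by move=> r0; rewrite -powRrM mulVf ?gt_eqF// powRr1.
rewrite -(e _ a0) -(e _ b0).
apply: powR_le_homo => //; [exact: ltW|exact: powR_ge0].
Qed.

(** If pR <= 1, w is a minimum-norm solution and [udag_unique] applies. If 1 < pR, the midpoint of w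
    and [udag] is a solution too, so its [bsum] is at least K by minimality, and [wsum_strict]
    concludes. *)
Lemma min_norm_solution_unique w : besov W sR pR w -> L2_eq (F w) v ->
  bsum W sR pR w <= K -> w = udag.
Proof.
move=> wB Fw wK; have [uB Fu umin] := hudag.
have [p1|p1] := leP pR 1.
  apply: udag_unique p1 _ _; split; [exact: wB|exact: Fw|move=> z zB Fz].
  apply: le_trans (umin z zB Fz).
  rewrite (besov_normE uB) (besov_normE wB) lee_fin.
  by apply: powR_le_homo => //; [rewrite invr_ge0 ltW|exact: bsum_ge0].
have [sB sc] := besovD hpR hWR wB uB.
have [mB mc] := besovZ hpR hWR 2^-1 sB.
have wD := embedding.1 _ wB; have uD := embedding.1 _ uB.
have sD' := embedding.1 _ sB.
have Fm : L2_eq (F (2^-1 *: (w + udag))) v.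
  apply/L2nrm_sub_eq0/eqP; rewrite eq_le L2nrm_ge0 andbT.
  apply: le_trans (L2nrm_triangle (2^-1 *: F (w + udag)) _ _) _.
  rewrite (operatorZ hWD F_linear _ hpD0)// add0r.
  apply: le_trans (L2nrm_triangle (2^-1 *: (F w + F udag)) _ _) _.
  rewrite -scalerBr L2nrmZ (operatorD F_linear)// mulr0 add0r.
  have -> : 2^-1 *: (F w + F udag) - v = 2^-1 *: ((F w - v) + (F udag - v)).
    exact: midpointB.
  rewrite L2nrmZ; apply: mulr_ge0_le0 => //.
  apply: le_trans (L2nrmD _ _) _.
  by move/L2nrm_sub_eq0 : Fw => ->; move/L2nrm_sub_eq0 : Fu => ->; rewrite addr0.
apply: (besov_ext wB uB).
apply: (@wsum_strict _ _ _ _ (bweight_gt0 W sR pR)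
  (pairing W w) (pairing W udag) K p1).
- by rewrite bsumE// lee_fin.
- by rewrite bsumE// lee_fin.
- rewrite (_ : (fun l => _) = pairing W (2^-1 *: (w + udag))); last first.
    by apply/funext => l; rewrite mc sc.
  rewrite (bsumE mB) lee_fin; exact: udag_minimal mB Fm.
Qed.

Lemma ultra_regularization (I : Type) (U : set_system I) (UU : UltraFilter U)
    (u : I -> test_function Omega -> R) :
  (\forall i \near U, besov W sR pR (u i)) ->
  (forall e : R, 0 < e -> \forall i \near U, bsum W sR pR (u i) <= K + e) ->
  (forall e : R, 0 < e -> \forall i \near U, L2nrm (F (u i) - v) <= e) ->
  forall e : R, 0 < e -> \forall i \near U, bsum W sR pR (u i - udag) <= e.
Proof.
move=> uB uK uF.
have PU : ProperFilter U by exact: ultra_proper.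
have FU : Filter U by exact: filter_filter.
have uK1 : \forall i \near U,
    (wsum pR (bweight W sR pR) (pairing W (u i)) <= (K + 1)%:E)%E.
  by apply: filterS2 uB (uK _ ltr01) => i uiB h; rewrite bsumE// lee_fin.
have /choice[c uc] : forall l, exists c : R, pairing W (u i) l @[i --> U] --> c.
  move=> l; have [B HB] := wsum_coef_bounded hpR (bweight_gt0 W sR pR) (K + 1) l.
  by apply: (@ultra_cvg_bounded _ _ _ UU _ B); apply: filterS uK1 => i /HB.
have cfin : (besov_sum sR pR c < +oo)%E.
  apply: le_lt_trans _ (ltry (K + 1)).
  exact: (wsum_fatou hpR PU uc uK1).
have [z [zB _ zc]] := besov_of_coef hWR cfin.
have x0 l : pairing W (u i - z) l @[i --> U] --> (0 : R).
  apply: (@cvg_trans _ ((pairing W (u i) l - c l) @[i --> U])).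
    (* [pairing] is known to be additive only on the Besov space, where [u i] lies eventually. *)
    apply: near_eq_cvg; apply: filterS uB => i uiB.
    by rewrite (besovB hpR hWR uiB zB).2 zc.
  by rewrite -(subrr (c l)); apply: cvgB; [exact: uc|exact: cvg_cst].
have [C C0 HC] := bsumB_le.
pose M := C * bsum W sR pR z + 2 * (K + 1).
have xM : \forall i \near U,
    besov W sR pR (u i - z) /\ bsum W sR pR (u i - z) <= M.
  apply: filterS2 uB (uK _ ltr01) => i uiB h; split.
    exact: (besovB hpR hWR uiB zB).1.
  by apply: le_trans (HC _ _ uiB zB) _; rewrite lerD2l ler_wpM2l.
have [M' HM'] := bsum_embedding M.
have Fz : L2_eq (F z) v.
  apply/L2nrm_sub_eq0; rewrite L2nrmBC.
  apply: (@banach_saks _ _ _ _ _ sD pD F hWD F_linear F_continuous I U PU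
    (fun i => u i - z) _ M' hpD) => //.
    by apply: filterS xM => i [xB /(HM' _ xB) h]; split;
      [exact: embedding.1|exact: h].
  move=> e e0; apply: filterS2 uB (uF e e0) => i uiB h.
  apply: le_trans (L2nrm_triangle (F (u i) - F z) _ _) _.
  rewrite (operatorB F_linear); [|exact: embedding.1..].
  by rewrite add0r opprB addrA subrK.
have Kz := udag_minimal zB Fz.
have gap (e : R) : 0 < e -> \forall i \near U,
    bsum W sR pR z + bsum W sR pR (u i - z) <= K + e.
  move=> e0; have e2 : 0 < e / 2 by lra.
  have zfin : (wsum pR (bweight W sR pR) (pairing W z) < +oo)%E.
    by rewrite bsumE// ltry.
  have xM' : \forall i \near U,
      (wsum pR (bweight W sR pR) (pairing W (u i - z)%R) <= M%:E)%E.
    by apply: filterS xM => i [xB xiM]; rewrite bsumE// lee_fin.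
  have BL := wsumD_ge_near hpR (bweight_gt0 W sR pR) FU zfin xM' x0 e2.
  apply: filterS3 uB BL (uK _ e2) => i uiB.
  have [xB xc] := besovB hpR hWR uiB zB.
  rewrite (_ : (fun l => _) = pairing W (u i)); last first.
    by apply/funext => l; rewrite xc addrC subrK.
  rewrite !bsumE// -!EFinD lee_fin; lra.
have zK : bsum W sR pR z <= K.
  apply/ler_addgt0Pr => e /gap/filter_ex[i]; apply: le_trans.
  by rewrite lerDl bsum_ge0.
(* Once z is [udag], the bound [Kz] cancels K in [gap] and leaves at most e for [u i - z]. *)
have <- := min_norm_solution_unique zB Fz zK.
by move=> e /gap; apply: filterS => i; lra.
Qed.

End Regularization.

(** * The Tikhonov functional and convergence of its minimizers *)

Section Tikhonov.
Context (R : realType) (d : nat) (Omega : set 'rV[R]_d).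
Context (mOmega : lebesgue_measurable Omega) (W : wavelet_basis mOmega).
Context (sR pR : R) (F : (test_function Omega -> R) -> L2 mOmega).
Hypothesis hpR : 0 < pR.

Lemma tikhonovE (a : R) (f : L2 mOmega) u : besov W sR pR u ->
  tikhonov W sR pR F a f u = (L2nrm (F u - f) ^+ 2 + a * bsum W sR pR u)%:E.
Proof.
by move=> uB; rewrite /tikhonov besov_norm_powR// -L2nrmE -EFin_expe -EFinM -EFinD.
Qed.

(** Outside B^sR_pR the norm is +oo, and so is the penalty because a and pR are positive. *)
Lemma tikhonov_lty_besov (a : R) (f : L2 mOmega) u : 0 < a ->
  (tikhonov W sR pR F a f u < +oo)%E -> besov W sR pR u.
Proof.
move=> a0; rewrite /tikhonov -L2nrmE -EFin_expe => h.
have [//|uB] := pselect (besov W sR pR u); move: h.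
by rewrite /besov_norm memNset// poweRyr ?gt_eqF// gt0_muley ?lte_fin//.
Qed.

End Tikhonov.

Theorem theorem3p1 (R : realType) (d : nat) (Omega : set 'rV[R]_d)
  (mOmega : lebesgue_measurable Omega) (W : wavelet_basis mOmega)
  (sD pD sR pR : R) (hpD : 1 < pD) (hpR : 0 < pR)
  (hWD : suitable W sD pD) (hWR : suitable W sR pR)
  (F : (test_function Omega -> R) -> L2 mOmega)
  (F_linear : linear_on_besov W sD pD F)
  (F_continuous : continuous_on_besov W sD pD F)
  (embedding : continuously_embedded W sR pR sD pD)
  (v : L2 mOmega) (udag : test_function Omega -> R)
  (hudag : min_norm_solution W sD pD sR pR F v udag)
  (udag_unique : pR <= 1 -> forall w,
     min_norm_solution W sD pD sR pR F v w -> w = udag)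
  (vdelta : R -> L2 mOmega)
  (hvdelta : forall delta : R, 0 < delta ->
     (L2_norm (v - vdelta delta)%R <= delta%:E)%E)
  (alpha : R -> R) (halpha : asymp alpha id)
  (u : R -> test_function Omega -> R)
  (hu : forall delta : R, 0 < delta ->
     tikhonov_minimizer W sD pD sR pR F (alpha delta) (vdelta delta)
       (u delta)) :
  besov_norm W sR pR (u delta - udag) @[delta --> 0^'+] --> 0%E.
Proof.
have [c [C [c0 C0 hal]]] := halpha.
have [udB Fud _] := hudag.
pose K := bsum W sR pR udag.
have K0 : 0 <= K by exact: bsum_ge0.
(* Compare the functional at [u t] and at [udag], whose residual is at most t. Dividing t^2 by
   alpha, with t <= C alpha, gives the term C t; alpha <= t / c gives the residual bound. *)
have bounds t : 0 < t -> [/\ besov W sR pR (u t), bsum W sR pR (u t) <= K + C * t &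
    L2nrm (F (u t) - vdelta t) ^+ 2 <= t ^+ 2 + t / c * K].
  move=> t0; have /andP[ca Ca] := hal _ t0; rewrite /= in ca Ca.
  have a0 : 0 < alpha t.
    by rewrite -(pmulr_rgt0 _ C0); apply: lt_le_trans Ca.
  have [uD /(_ udag (embedding.1 _ udB))] := hu _ t0.
  rewrite (tikhonovE _ hpR _ _ udB) => tu.
  have uB : besov W sR pR (u t).
    by apply: (tikhonov_lty_besov hpR a0 (le_lt_trans tu (ltry _))).
  have nt : L2nrm (F udag - vdelta t) <= t.
    by rewrite (L2nrm_eql _ Fud) -lee_fin L2nrmE; exact: hvdelta.
  have nt2 : L2nrm (F udag - vdelta t) ^+ 2 <= t ^+ 2.
    by rewrite ler_sqr// nnegrE ?L2nrm_ge0// ltW.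
  move: tu; rewrite (tikhonovE _ hpR _ _ uB) lee_fin -/K => tu.
  have S0 : 0 <= bsum W sR pR (u t) by exact: bsum_ge0.
  have n0 := sqr_ge0 (L2nrm (F (u t) - vdelta t)).
  have at_ : alpha t <= t / c by rewrite ler_pdivlMr// mulrC.
  split => //; last by nra.
  have : alpha t * bsum W sR pR (u t) <= alpha t * (K + C * t) by nra.
  by rewrite ler_pM2l.
have near_small (r : R) : 0 < r -> \forall t \near 0^'+, 0 < t <= r.
  move=> r0; near=> t; apply/andP; split; near: t.
    exact: nbhs_right_gt.
  exact: nbhs_right_le.
have uB : \forall t \near 0^'+, besov W sR pR (u t).
  by apply: filterS (near_small _ ltr01) => t /andP[/bounds[]].
have uK (e : R) : 0 < e -> \forall t \near 0^'+, bsum W sR pR (u t) <= K + e.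
  move=> e0; apply: filterS (near_small _ (divr_gt0 e0 C0)) => t /andP[t0 te].
  have [_ h _] := bounds _ t0; apply: le_trans h _.
  by rewrite lerD2l mulrC -ler_pdivlMr.
have uF (e : R) : 0 < e -> \forall t \near 0^'+, L2nrm (F (u t) - v) <= e.
  move=> e0.
  have e20 : 0 < e / 2 by lra.
  have q0 : 0 < 1 + K / c by rewrite ltr_wpDr// divr_ge0// ltW.
  have r0 : 0 < (e / 2) ^+ 2 / (1 + K / c) by rewrite divr_gt0// exprn_gt0.
  near=> t.
  (* Since t <= 1, t^2 + t K / c is at most t (1 + K / c), which the third condition on t makes at
     most (e/2)^2. *)
  have /andP[t0 t1] : 0 < t <= 1 by near: t; exact: near_small.
  have /andP[_ te] : 0 < t <= e / 2 by near: t; exact: near_small.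
  have /andP[_ tr] : 0 < t <= (e / 2) ^+ 2 / (1 + K / c).
    by near: t; exact: near_small.
  have [_ _ h] := bounds _ t0.
  have n1 : L2nrm (F (u t) - vdelta t) <= e / 2.
    rewrite -ler_sqr ?nnegrE ?L2nrm_ge0 ?(ltW e20)//; apply: le_trans h _.
    rewrite ler_pdivlMr// in tr; apply: le_trans tr.
    rewrite mulrDr mulr1 mulrAC -mulrA mulrCA lerD2r expr2; nra.
  have n2 : L2nrm (vdelta t - v) <= e / 2.
    by rewrite L2nrmBC; apply: le_trans te; rewrite -lee_fin L2nrmE; exact: hvdelta.
  apply: le_trans (L2nrm_triangle (vdelta t) _ _) _; lra.
have key (e : R) : 0 < e ->
    \forall t \near 0^'+, bsum W sR pR (u t - udag) <= e.
  (* The eventual properties [uB], [uK] and [uF] are inherited by every finer ultrafilter. *)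
  move=> e0; apply: filter_of_ultra => U UU sub.
  apply: (ultra_regularization hpD hpR hWD hWR F_linear F_continuous embedding
    hudag udag_unique UU _ _ _ e0).
  - exact: sub uB.
  - by move=> e' e'0; exact: sub (uK _ e'0).
  - by move=> e' e'0; exact: sub (uF _ e'0).
have EN : \forall t \near 0^'+, besov_norm W sR pR (u t - udag) =
    (bsum W sR pR (u t - udag) `^ pR^-1)%:E.
  apply: filterS uB => t utB; apply: besov_normE.
  exact: (besovB hpR hWR utB udB).1.
apply: cvg_EFin; first by apply: filterS EN => t ->.
apply/cvgr0Pnorm_le => e e0.
have ep : 0 < e `^ pR by exact: powR_gt0.
apply: filterS2 EN (key _ ep) => t /= -> /= h.
rewrite ger0_norm ?powR_ge0//.
have -> : e = (e `^ pR) `^ pR^-1.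
  by rewrite -powRrM mulfV ?gt_eqF// powRr1// ltW.
apply: powR_le_homo => //; last exact: bsum_ge0.
by rewrite invr_ge0 ltW.
Unshelve. all: by end_near. Qed.
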